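(* Let $\phi\colon X\rightarrow Y$ be a continuous surjection between compact Hausdorff spaces. Then $\phi$ is irreducible if and only if $2^\phi\colon 2^X\rightarrow 2^Y$ is irreducible.
   Context: For a compact Hausdorff space $X$, the hyperspace $2^X$ is the collection of all non-empty closed subsets of $X$ equipped with the Vietoris topology, a base of which is formed by the sets $\langle U_1,\dotsc,U_n\rangle:=\{K\in 2^X\mid K\subseteq U_1\cup\dotsm\cup U_n,\ K\cap U_i\neq\emptyset,\ 1\le i\le n\}$ for all $n\ge 1$ and all non-empty open sets $U_1,\dotsc,U_n$ in $X$. With this topology $2^X$ is a compact Hausdorff space. A continuous surjection $\phi\colon X\to Y$ of compact Hausdorff spaces induces the continuous surjection $2^\phi\colon 2^X\to 2^Y$, $K\mapsto\phi[K]$. A continuous surjection $g\colon A\to B$ between compact Hausdorff spaces is irreducible if the only non-empty closed subset $C$ of $A$ with $g[C]=B$ is $A$ itself. *)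

(* Defs.v *)
From HB Require Import structures.
From mathcomp Require Import all_boot all_order all_algebra.
From mathcomp Require Import boolp classical_sets functions.
From mathcomp Require Import topology.

Set Implicit Arguments.
Unset Strict Implicit.
Unset Printing Implicit Defensive.

Local Open Scope classical_set_scope.

Record hyperspace (X : topologicalType) : Type := Hyperspace {
  hyperspace_set :> set X ;
  hyperspace_closed : closed hyperspace_set ;
  hyperspace_nonempty : hyperspace_set !=set0
}.

Lemma hyperspace_inj (X : topologicalType) (K L : hyperspace X) :
  hyperspace_set K = hyperspace_set L -> K = L.
Proof.
case: K L => [K cK nK] [L cL nL] /= KL; subst L.
by rewrite (Prop_irrelevance cK cL) (Prop_irrelevance nK nL).
Qed.

(* The set <U_0, ..., U_(n-1)>. *)
Definition vietoris_basic (X : topologicalType) (n : nat)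
    (U : 'I_n -> set X) : set (hyperspace X) :=
  [set K | (K : set X) `<=` \bigcup_i U i /\
           forall i, (K : set X) `&` U i !=set0].

Definition vietoris_base (X : topologicalType) : set (set (hyperspace X)) :=
  [set B | exists (n : nat) (U : 'I_n -> set X),
     [/\ (1 <= n)%N,
         forall i, open (U i),
         forall i, U i !=set0 &
         B = vietoris_basic U]].

Lemma vietoris_base_cover (X : topologicalType) :
  \bigcup_(B in @vietoris_base X) B = setT.
Proof.
rewrite -subTset => K _.
have [x Kx] := hyperspace_nonempty K.
exists (vietoris_basic (fun _ : 'I_1 => [set: X])).
  exists 1, (fun=> setT); split=> // i; first exact: openT.
  by exists x.
split=> [y _|i]; last by exists x.
by exists ord0.
Qed.

Lemma vietoris_base_join (X : topologicalType) (A B : set (hyperspace X))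
    (K : hyperspace X) :
  vietoris_base A -> vietoris_base B -> A K -> B K ->
  exists C, [/\ vietoris_base C, C K & C `<=` A `&` B].
Proof.
move=> [n [U [n1 oU _ ->]]] [m [V [m1 oV _ ->]]] [KU KUi] [KV KVj].
pose W (k : 'I_(n + m)) := match fintype.split k with
  | inl i => U i `&` \bigcup_j V j
  | inr j => \bigcup_i U i `&` V j
  end.
have WL i : W (lshift m i) = U i `&` \bigcup_j V j.
  by rewrite /W -[lshift _ _]/(unsplit (inl i)) unsplitK.
have WR j : W (rshift n j) = \bigcup_i U i `&` V j.
  by rewrite /W -[rshift _ _]/(unsplit (inr j)) unsplitK.
have WK k : (K : set X) `&` W k !=set0.
  rewrite /W; case: (fintype.split k) => i.
    by have [x [Kx Ux]] := KUi i; exists x; do 2?split=> //; exact: KV.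
  by have [x [Kx Vx]] := KVj i; exists x; do 2?split=> //; exact: KU.
exists (vietoris_basic W); split.
- exists (n + m)%N, W; split=> //; first by rewrite addn_gt0 n1.
    move=> k; rewrite /W; case: (fintype.split k) => i; apply: openI => //;
      exact: bigcup_open.
  by move=> k; have [x [_ Wx]] := WK k; exists x.
- split=> // x Kx; have [i _ Ux] := KU x Kx; exists (lshift m i) => //.
  by rewrite WL; split=> //; exact: KV.
- move=> L [LW LWk].
  have LUV x : (L : set X) x -> (\bigcup_i U i) x /\ (\bigcup_j V j) x.
    move=> /LW [k _]; rewrite /W; case: (fintype.split k) => i [Wx1 Wx2] //.
      by split=> //; exists i.
    by split=> //; exists i.
  split; split.
  + by move=> x /LUV[].
  + by move=> i; have [x] := LWk (lshift m i); rewrite WL => -[Lx [Ux _]]; exists x.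
  + by move=> x /LUV[].
  + by move=> j; have [x] := LWk (rshift n j); rewrite WR => -[Lx [_ Vx]]; exists x.
Qed.

HB.instance Definition _ (X : topologicalType) := gen_eqMixin (hyperspace X).
HB.instance Definition _ (X : topologicalType) :=
  gen_choiceMixin (hyperspace X).
HB.instance Definition _ (X : topologicalType) :=
  @isBaseTopological.Build (hyperspace X) (set (hyperspace X))
    (@vietoris_base X) id (@vietoris_base_cover X) (@vietoris_base_join X).

Lemma vietoris_openE (X : topologicalType) (O : set (hyperspace X)) :
  open O <->
  forall K, O K -> exists B, [/\ vietoris_base B, B K & B `<=` O].
Proof.
rewrite openE; split=> [oO K /oO | h K /h [B [bB BK BO]]].
  move=> [P [[D sD <-] [B DB BK] PO]].
  exists B; split=> //; first exact: sD.
  by move=> L BL; apply: PO; exists B.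
exists B; split=> //; exists [set B]; first by move=> _ ->.
by rewrite bigcup_set1.
Qed.

Section hyperspace_map.
Variables (X Y : topologicalType) (phi : X -> Y).
Hypotheses (cptX : compact [set: X]) (hausY : hausdorff_space Y)
  (ctsphi : continuous phi).

Lemma closed_image_compact_hausdorff (K : set X) :
  closed K -> closed (phi @` K).
Proof.
move=> clK; apply: compact_closed => //; apply: continuous_compact.
  exact: continuous_subspaceT.
exact: subclosed_compact clK cptX _.
Qed.

(* The map 2^phi; the hypotheses on X, Y and phi make phi[K] closed. *)
Definition hyperspace_map (K : hyperspace X) : hyperspace Y :=
  Hyperspace (closed_image_compact_hausdorff (@hyperspace_closed _ K))
    (image_nonempty phi (hyperspace_nonempty K)).

Lemma hyperspace_map_continuous : continuous hyperspace_map.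
Proof.
apply/continuousP => O /vietoris_openE oO; apply/vietoris_openE => K /oO.
move=> [_ [[n [V [n1 oV nV ->]]] [KV KVi] VO]].
have KU i : (K : set X) `&` phi @^-1` V i !=set0.
  by have [_ [[x Kx <-] Vx]] := KVi i; exists x.
exists (vietoris_basic (fun i => phi @^-1` V i)); split.
- exists n, (fun i => phi @^-1` V i); split=> // i.
    by move/continuousP: ctsphi; apply.
  by have [x [_ Vx]] := KU i; exists x.
- split=> // x Kx; have [|i _ Vx] := KV (phi x); first by exists x.
  by exists i.
- move=> L [LV LVi]; apply: VO; split=> [_ [x Lx <-]|i].
    by have [i _ Vx] := LV x Lx; exists i.
  by have [x [Lx Vx]] := LVi i; exists (phi x); split=> //; exists x.
Qed.

Lemma hyperspace_map_surj :
  set_surj [set: X] [set: Y] phi ->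
  set_surj [set: hyperspace X] [set: hyperspace Y] hyperspace_map.
Proof.
move=> sphi L _.
have clK : closed (phi @^-1` L).
  by apply: preimage_closed (@hyperspace_closed _ L) => x _; exact: ctsphi.
have nK : phi @^-1` L !=set0.
  have [y Ly] := hyperspace_nonempty L.
  by have [x _ xy] := sphi y I; exists x; rewrite /= xy.
exists (Hyperspace clK nK) => //; apply: hyperspace_inj => /=.
apply/seteqP; split=> [_ [x Lx <-] //|y Ly].
by have [x _ xy] := sphi y I; exists x => //=; rewrite xy.
Qed.

End hyperspace_map.

(* Applied only to continuous surjections between compact Hausdorff spaces; for
   such g with A nonempty, C = A is itself a nonempty closed set with
   g @` C = B, so this says that A is the only one. *)
Definition irreducible_map (A B : topologicalType) (g : A -> B) : Prop :=
  forall C : set A, C !=set0 -> closed C -> g @` C = [set: B] -> C = [set: A].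

(* Main.v *)
(* If [phi] is irreducible, every non-empty open U contains a whole fibre of
   [phi], as otherwise the complement of U would map onto Y.  A family that
   [2^phi] maps onto [2^Y] contains some M over {y_1, ..., y_n}, where the
   fibre of y_i lies in U_i; then M is in <U_1, ..., U_n>, so the family is
   dense.  Conversely, if a closed C maps onto Y, then the closed subsets of C
   form a closed subset of [2^X] that [2^phi] maps onto [2^Y]. *)
Require Import Defs.
From mathcomp Require Import all_boot.
From mathcomp Require Import boolp classical_sets functions.
From mathcomp Require Import cardinality topology.

Local Open Scope classical_set_scope.

Lemma irreducible_map_fiber {A B : topologicalType} {g : A -> B} {U : set A} :
  irreducible_map g -> open U -> U !=set0 ->
  exists y, g @^-1` [set y] `<=` U.
Proof.
move=> irrg oU [x Ux]; apply: contrapT => noy.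
have gU : g @` (~` U) = [set: B].
  rewrite -subTset => y _; apply: contrapT => nUy; apply: noy.
  by exists y => z gz; apply: contrapT => nUz; apply: nUy; exists z.
(* Irreducibility speaks of non-empty sets only; a point over [g x] shows that the complement of [U]
   is one. *)
have [z nUz _] : (g @` (~` U)) (g x) by rewrite gU.
have UT : ~` U = [set: A].
  by apply: irrg gU; [exists z | exact: open_closedC].
by have : (~` U) x by rewrite UT.
Qed.

(** Hausdorff spaces are T1, so finite sets are closed; this turns finitely many points of [Y] into
    an element of [hyperspace Y]. *)
Lemma closed_range_ord {Y : topologicalType} {n : nat} (y : 'I_n -> Y) :
  hausdorff_space Y -> closed (range y).
Proof.
move=> /hausdorff_accessible/accessible_finite_set_closed; apply.
exact/finite_image/finite_finset.
Qed.

Lemma closed_hyperspace_sub {X : topologicalType} (C : set X) :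
  closed C -> closed [set K : hyperspace X | (K : set X) `<=` C].
Proof.
move=> clC; rewrite -openC; apply/vietoris_openE => K.
move=> /existsNP[x /not_implyP[Kx nCx]].
(* Including [[set: X]] makes the covering condition void, so only meeting the complement of [C] is
   required. *)
pose U (i : 'I_2) := if i == ord0 then [set: X] else ~` C.
exists (vietoris_basic U); split.
- exists 2, U; split=> // i; rewrite /U; case: ifP => _.
  + exact: openT.
  + exact: closed_openC.
  + by exists x.
  + by exists x.
- split=> [z _|i]; first by exists ord0.
  by exists x; rewrite /U; case: ifP.
- by move=> L [_ /(_ ord_max)[z [Lz nCz]]] /(_ z Lz).
Qed.

Section hyperspace_map_irreducible.
Context {X Y : topologicalType} {phi : X -> Y}.
Hypotheses (cptX : compact [set: X]) (hausY : hausdorff_space Y)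
  (ctsphi : continuous phi).

Lemma irreducible_hyperspace_map :
  irreducible_map phi -> irreducible_map (hyperspace_map cptX hausY ctsphi).
Proof.
move=> irrphi C _ clC phiC; rewrite -subTset => K _; apply: contrapT => nCK.
have /vietoris_openE /(_ K nCK) := closed_openC clC.
move=> [_ [[n [U [n1 oU nU ->]]] _ UC]].
have /choice[y yU] i := irreducible_map_fiber irrphi (oU i) (nU i).
(* [n1] provides an index, so the finite set is non-empty. *)
have ny : range y !=set0 by exists (y (Ordinal n1)), (Ordinal n1).
have [M CM phiM] : (hyperspace_map cptX hausY ctsphi @` C)
    (Hyperspace (closed_range_ord y hausY) ny) by rewrite phiC.
have {}phiM :
    phi @` M = range y := congr1 (@hyperspace_set Y) phiM.
(* Each point of [M] lies in the fibre of some [y i], hence in [U i]; each [y i] is attained on [M],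
   so [M] meets every [U i]. *)
apply: (UC M) CM; split=> [x Mx|i].
  have [i _ yi] : range y (phi x) by rewrite -phiM; exists x.
  by exists i => //; exact: yU.
have [x Mx xy] : (phi @` M) (y i) by rewrite phiM; exists i.
by exists x; split=> //; exact: yU.
Qed.

Lemma hyperspace_map_irreducible :
  irreducible_map (hyperspace_map cptX hausY ctsphi) -> irreducible_map phi.
Proof.
move=> irr C [c Cc] clC phiC.
(* The part of [C] over [L] will serve as the preimage of [L] under the induced map. *)
have fibC (L : set Y) : L `<=` phi @` (C `&` phi @^-1` L).
  move=> y Ly; have [x Cx xy] : (phi @` C) y by rewrite phiC.
  by exists x => //; split=> //=; rewrite xy.
have subC : [set K : hyperspace X | (K : set X) `<=` C] = [set: hyperspace X].
  apply: irr.
  - have nC : (C : set X) !=set0 by exists c.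
    by exists (Hyperspace clC nC).
  - exact: closed_hyperspace_sub.
  - rewrite -subTset => L _.
    have clK : closed (C `&` phi @^-1` L).
      apply: closedI => //.
      by apply: preimage_closed (@hyperspace_closed _ L) => x _; exact: ctsphi.
    have nK : C `&` phi @^-1` L !=set0.
      have [y Ly] := hyperspace_nonempty L.
      by have [x Kx _] := fibC L y Ly; exists x.
    exists (Hyperspace clK nK); first by move=> x [].
    apply: hyperspace_inj; apply/seteqP; split; last exact: fibC.
    by move=> _ [x [_ Lx] <-].
(* The whole space is itself a point of [hyperspace X], so [subC] puts it inside [C]. *)
have nT : [set: X] !=set0 by exists c.
have : [set K : hyperspace X | (K : set X) `<=` C] (Hyperspace closedT nT).
  by rewrite subC.
by rewrite /= subTset.
Qed.

End hyperspace_map_irreducible.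

Theorem mainTheorem5 (X Y : topologicalType)
    (cptX : compact [set: X]) (hausX : hausdorff_space X)
    (cptY : compact [set: Y]) (hausY : hausdorff_space Y)
    (phi : X -> Y) (ctsphi : continuous phi)
    (surjphi : set_surj [set: X] [set: Y] phi) :
  irreducible_map phi <->
  irreducible_map (hyperspace_map cptX hausY ctsphi).
Proof.
split; first exact: irreducible_hyperspace_map.
exact: hyperspace_map_irreducible.
Qed.
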